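(* Let $B \ge 2$ be an integer base. For any $k \ge 1$, there are at most $\frac{(B-2)(B-3)}{2}$ solutions of $P^*_k$ in base $B$, i.e. at most that many numbers $N_k = [a_1\dots a_k\, b\, c_1\dots c_k]$ with $a_1 \ne 0$ having property $P^*_k$.
   Context: Fix an integer base $B \ge 2$. A digit is an integer $x$ with $0 \le x < B$, and for digits $x_1,\dots,x_m$ write $[x_1x_2\dots x_m] = \sum_{i=1}^m x_i B^{m-i}$. For $k \ge 1$ consider a number $N_k = [a_1\dots a_k\, b\, c_1\dots c_k]$ with digits $a_i, b, c_i$ and $a_1 \neq 0$, and put $a = [a_1\dots a_k]$, $c = [c_1\dots c_k]$. $N_k$ has property $P_k$ if $[a_1\dots a_k\, b]\cdot[c_1\dots c_k] = [a_1\dots a_k]\cdot[b\, c_1\dots c_k]$, equivalently $(aB+b)c = a(bB^k + c)$. $N_k$ has property $P^*_k$ (is a solution of $P^*_k$) if it has property $P_k$, no two of $a, b, c$ are $0$, and the digits $a_1,\dots,a_k,b,c_1,\dots,c_k$ are not all equal. *)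

(* Defs.v *)
From mathcomp Require Import all_boot all_order all_algebra.

Set Implicit Arguments.
Unset Strict Implicit.
Unset Printing Implicit Defensive.

(** MathComp; digit strings are sequences of natural numbers, most significant
    digit first. *)

Definition is_digit (B x : nat) : bool := x < B.

(** [x_1 x_2 ... x_m] = \sum_(1 <= i <= m) x_i B^(m - i); positions in the
    sequence are counted from 0, hence the [i.+1]. *)
Definition numeral (B : nat) (x : seq nat) : nat :=
  \sum_(i < size x) nth 0 x i * B ^ (size x - i.+1).

Definition propP (B : nat) (a : seq nat) (b : nat) (c : seq nat) : Prop :=
  numeral B (rcons a b) * numeral B c = numeral B a * numeral B (b :: c).

Definition no_two_zero (x y z : nat) : Prop :=
  [/\ ~ (x = 0 /\ y = 0), ~ (x = 0 /\ z = 0) & ~ (y = 0 /\ z = 0)].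

Definition propPstar (B : nat) (a : seq nat) (b : nat) (c : seq nat) : Prop :=
  [/\ propP B a b c,
      no_two_zero (numeral B a) b (numeral B c)
    & ~~ constant (a ++ b :: c)].

(** Since the length is fixed to 2k+1, the digit string witnessing that N is a
    solution is determined by N, so counting such N or such strings is the
    same. *)
Definition solution_Pstar (B k N : nat) : Prop :=
  exists (a : seq nat) (b : nat) (c : seq nat),
    [/\ size a = k /\ size c = k,
        all (is_digit B) (a ++ b :: c),
        head 0 a != 0,
        N = numeral B (a ++ b :: c)
      & propPstar B a b c].

(* Main.v *)
Require Import Defs.
From mathcomp Require Import all_boot all_order all_algebra.
From mathcomp Require Import zify ring lra.
Import Order.TTheory GRing.Theory Num.Theory.

(** Write n = B - 1 and let R be the repunit [11...1] with k digits, so that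
    n R + 1 = B^k. The defining equation is c (n a + b) = a b B^k. Measure c
    by its defect t = b R - c from the constant string [bb...b]. The equation
    then becomes

      a (b + n t) = b c,   and, with X = n a + b,   X (b + n t) = b^2 B^k.

    Hence the pair (b, t) determines c, then a, then N, and it suffices to
    count pairs. The size constraints give t >= 0, and t = 0 forces
    a = c = b R, the excluded constant string. The leading digit of a is
    nonzero, so X > n B^(k-1), whence n (b + n t) < b^2 B. This inequality
    alone yields t <= b - 2 unless b is n or n - 1 and t = b - 1
    ([defect_bound]). In these two cases b + n t is n^2 and n^2 - n - 1
    respectively, and the factorization of b^2 B^k is excluded by arithmetic,
    B being coprime to n and to n^2 - n - 1 ([defect_not_pred]).

    Thus 1 <= t <= b - 2 and b <= B - 1 ([defect_range]). Shifting, N is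
    indexed by a pair i < j < B - 2, where i = t - 1 and j = b - 2, and there
    are 'C(B - 2, 2) such pairs. *)

Local Open Scope nat_scope.

(** * Numerals *)

Lemma numeral_cons (B x : nat) (s : seq nat) :
  numeral B (x :: s) = x * B ^ size s + numeral B s.
Proof. by rewrite /numeral /= big_ord_recl /= subn1. Qed.

Lemma numeral_nil (B : nat) : numeral B [::] = 0.
Proof. by rewrite /numeral big_ord0. Qed.

Lemma numeral_cat (B : nat) (s1 s2 : seq nat) :
  numeral B (s1 ++ s2) = numeral B s1 * B ^ size s2 + numeral B s2.
Proof.
elim: s1 => [|x s1 IH]; first by rewrite numeral_nil.
by rewrite cat_cons !numeral_cons IH size_cat expnD mulnDl mulnA addnA.
Qed.

Lemma numeral_rcons (B x : nat) (s : seq nat) :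
  numeral B (rcons s x) = numeral B s * B + x.
Proof.
by rewrite -cats1 numeral_cat numeral_cons numeral_nil /= expn0 expn1 muln1 addn0.
Qed.

Lemma numeral_lt (B : nat) (s : seq nat) :
  all (is_digit B) s -> numeral B s < B ^ size s.
Proof.
elim: s => [|x s IH] /=; first by rewrite numeral_nil.
case/andP=> ltxB /IH lt_s; rewrite numeral_cons expnS.
by rewrite /is_digit in ltxB; nia.
Qed.

Lemma leq_numeral (B : nat) (s : seq nat) :
  head 0 s != 0 -> B ^ (size s).-1 <= numeral B s.
Proof. by case: s => [|x s] //= x_neq0; rewrite numeral_cons; nia. Qed.

Lemma numeral_inj (B : nat) (s1 s2 : seq nat) :
    all (is_digit B) s1 -> all (is_digit B) s2 -> size s1 = size s2 ->
  numeral B s1 = numeral B s2 -> s1 = s2.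
Proof.
elim: s1 s2 => [|x s1 IH] [|y s2] //= /andP[_ ds1] /andP[_ ds2] [eq_sz].
rewrite !numeral_cons -eq_sz => eqN.
have lt1 := numeral_lt _ _ ds1; have := numeral_lt _ _ ds2; rewrite -eq_sz => lt2.
have eqxy : x = y by nia.
by congr (_ :: _) => //; apply: IH => //; nia.
Qed.

Definition repunit (B k : nat) : nat := numeral B (nseq k 1).

Lemma numeral_nseq (B k x : nat) : numeral B (nseq k x) = x * repunit B k.
Proof.
elim: k => [|k IH]; first by rewrite /repunit numeral_nil muln0.
by rewrite /repunit /= !numeral_cons IH !size_nseq mul1n mulnDr.
Qed.

Lemma repunitE (n k : nat) : n * repunit n.+1 k + 1 = n.+1 ^ k.
Proof.
elim: k => [|k IH]; first by rewrite /repunit numeral_nil muln0.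
by rewrite /repunit /= numeral_cons size_nseq -/(repunit _ _) expnS -IH; ring.
Qed.

(** * The defect of a solution *)

(** Since b <= n, a string c exceeding [bb...b] would have n c >= b B^k, and
    the term b c would be left over in the equation. *)
Lemma leq_repdigit (n k a b c : nat) : 0 < b <= n -> 0 < c ->
    c * (n * a + b) = a * b * n.+1 ^ k ->
  c <= b * repunit n.+1 k.
Proof.
case/andP=> b_gt0 le_bn c_gt0; rewrite -repunitE leqNgt => eqE.
apply/negP; move: eqE; set r := repunit _ _ => eqE lt_c.
have le_nc : b * (n * r + 1) <= n * c by nia.
have : a * (b * (n * r + 1)) <= a * (n * c) by rewrite leq_mul2l le_nc orbT.
by nia.
Qed.

(** Substituting B^k = n R + 1 and b R = c + t, the terms n a c cancel. What is
    left determines a from b and t. *)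
Lemma defect_eq (n k a b c t : nat) :
    c + t = b * repunit n.+1 k -> c * (n * a + b) = a * b * n.+1 ^ k ->
  a * (b + n * t) = b * c.
Proof. by rewrite -repunitE => eq_t; nia. Qed.

(** Completing the product: the terms in n a and n t of the equation combine so
    that the right-hand side no longer contains a or t, which turns size and
    divisibility constraints on n a + b into constraints on t. *)
Lemma defect_factorization (n k a b c t : nat) :
    c + t = b * repunit n.+1 k -> a * (b + n * t) = b * c ->
  (n * a + b) * (b + n * t) = b ^ 2 * n.+1 ^ k.
Proof.
move=> eq_t eq_a; rewrite mulnDl -mulnA eq_a -repunitE -mulnn.
have -> : b * b * (n * repunit n.+1 k + 1) = n * b * (b * repunit n.+1 k) + b * b.
  by ring.
by rewrite -eq_t; ring.
Qed.

(** Only the size of b + n t matters here: for t >= b - 1 the hypothesis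
    entails n (b - 1) (n - b) < b^2, impossible when 2 <= b <= n - 2. *)
Lemma defect_bound (n b t : nat) : 0 < t -> 0 < b <= n ->
    n * (b + n * t) < b ^ 2 * n.+1 -> b.-1 <= t ->
  [/\ 1 < b, t = b.-1 & b = n \/ b = n.-1].
Proof.
move=> t_gt0 /andP[b_gt0 /subnKC <-]; move: (n - b) => {n}d.
case: b b_gt0 => // -[|m] _ ltY /= le_t.
  suff: (1 + d) * (1 + (1 + d) * 1) <= (1 + d) * (1 + (1 + d) * t) by nia.
  by rewrite leq_mul2l leq_add2l leq_mul2l t_gt0 !orbT.
move: ltY; rewrite -(subnKC le_t); move: (t - m.+1) => {t le_t t_gt0}e.
set b := m.+2; set n := b + d => ltY.
have eqY : n * (b + n * (m.+1 + e)) = b ^ 2 * n + n * (m.+1 * d) + n * (n * e).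
  by rewrite /n /b; ring.
have lt_de : n * (m.+1 * d) + n * (n * e) < b ^ 2.
  by rewrite eqY mulnS [X in _ < X]addnC -addnA ltn_add2l in ltY.
have le_d : d <= 1.
  rewrite leqNgt; apply/negP => d_gt1.
  have : (b + 2) * (m.+1 * 2) <= n * (m.+1 * d).
    by rewrite leq_mul ?leq_add2l ?leq_mul2l.
  by rewrite /b in lt_de *; nia.
have e0 : e = 0.
  (* A positive e would contribute n^2 e >= b^2. *)
  apply/eqP; rewrite -leqn0 leqNgt; apply/negP => e_gt0.
  have : b * (b * 1) <= n * (n * e) by rewrite !leq_mul // leq_addr.
  by rewrite muln1 mulnn; lia.
rewrite e0 addn0; split=> //.
case: d le_d @n {ltY eqY lt_de} => [|[|d]] //= _; last by right; rewrite addn1.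
by left; rewrite addn0.
Qed.

(** When t = b - 1, the number b + n t is n^2 for b = n, and n^2 - n - 1 for
    b = n - 1. In the first case, cancelling n^2 leaves n (a + 1) = B^k, although
    n > 1 is coprime to B. In the second, n^2 - n - 1 = B (n - 2) + 1 is coprime
    to B, so it would divide (n - 1)^2, which is smaller. *)
Lemma defect_not_pred (n k a b : nat) : 1 < b -> b = n \/ b = n.-1 ->
  (n * a + b) * (b + n * b.-1) <> b ^ 2 * n.+1 ^ k.
Proof.
move=> b_gt1 eq_b eqXY.
have [eq_bn | eq_bn] := eq_b.
  rewrite eq_bn in eqXY b_gt1.
  have dvd_n : n %| n.+1 ^ k.
    rewrite -(@dvdn_pmul2l (n ^ 2)) ?expn_gt0 ?(ltnW b_gt1) // -eqXY.
    have -> : (n * a + n) * (n + n * n.-1) = n ^ 2 * n * a.+1 by nia.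
    exact: dvdn_mulr.
  have : coprime n (n.+1 ^ k) by rewrite coprimeXr // coprimenS.
  by rewrite /coprime (gcdn_idPl dvd_n) => /eqP n1; rewrite n1 in b_gt1.
have eq_n : n = b.+1 by lia.
rewrite {}eq_n in eqXY.
case: b b_gt1 eqXY {eq_b eq_bn} => // m m_gt0 /= eqXY.
set Y := _ + _ * m in eqXY.
have coY : coprime Y (m.+3 ^ k).
  apply: coprimeXr.
  have -> : Y = m * m.+3 + 1 by rewrite /Y; ring.
  by rewrite /coprime gcdnC gcdnMDl gcdn1.
have : Y %| m.+1 ^ 2 * m.+3 ^ k by rewrite -eqXY dvdn_mull.
rewrite Gauss_dvdl // => /dvdn_leq; rewrite expn_gt0 => /(_ isT).
by rewrite /Y; nia.
Qed.

(** The lower bound B^(k-1) <= a is the effect of a nonzero leading digit: it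
    makes n a + b large, hence its cofactor b + n t small. *)
Lemma defect_range (n k a b c : nat) : 0 < k -> 0 < b <= n -> 0 < c ->
    n.+1 ^ k.-1 <= a -> c <> b * repunit n.+1 k ->
    c * (n * a + b) = a * b * n.+1 ^ k ->
  0 < b * repunit n.+1 k - c <= b - 2.
Proof.
move=> k_gt0 b_bnd c_gt0 le_a neq_c eqE.
have le_c := leq_repdigit _ _ _ _ _ b_bnd c_gt0 eqE.
set t := _ - c; have eq_t : c + t = b * repunit n.+1 k by rewrite subnKC.
have t_gt0 : 0 < t by rewrite subn_gt0 ltn_neqAle le_c andbT; apply/eqP.
have eq_a := defect_eq _ _ _ _ _ _ eq_t eqE.
have eqXY := defect_factorization _ _ _ _ _ _ eq_t eq_a.
rewrite t_gt0 /= leqNgt; apply/negP => lt_t.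
have Bk_gt0 : 0 < n.+1 ^ k.-1 by rewrite expn_gt0.
have ltY : n * (b + n * t) < b ^ 2 * n.+1.
  rewrite -(ltn_pmul2r Bk_gt0) -[X in _ < X]mulnA -expnS prednK // -eqXY.
  have le_nY : n * (b + n * t) * n.+1 ^ k.-1 <= n * (b + n * t) * a.
    by rewrite leq_mul2l le_a orbT.
  by nia.
have [b_gt1 eq_tb eq_bn] := defect_bound n b t t_gt0 b_bnd ltY ltac:(lia).
by rewrite eq_tb in eqXY; apply: defect_not_pred eqXY.
Qed.

(** * Counting *)

(** For a solution with middle digit b and defect t, the relation
    a (b + (B - 1) t) = b c makes the division exact, its quotient being a. *)
Definition defect_solution (B k b t : nat) : nat :=
  let c := b * repunit B k - t in
  (b * c %/ (b + B.-1 * t)) * B ^ k.+1 + (b * B ^ k + c).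

Lemma solution_defect (B k N : nat) : 1 < B -> 0 < k -> solution_Pstar B k N ->
  exists b t, [/\ 0 < t <= b - 2, b < B & N = defect_solution B k b t].
Proof.
case: B => [|n] // n_gt0 k_gt0 [a [b [c [[sz_a sz_c] digs a_neq0 -> [eqE nz ncst]]]]].
move: digs; rewrite all_cat /= => /and3P[dig_a lt_b dig_c].
rewrite /is_digit in lt_b.
move: eqE; rewrite /propP numeral_rcons numeral_cons sz_c => eqE.
have le_a := leq_numeral n.+1 a a_neq0; rewrite sz_a in le_a.
have a_gt0 : 0 < numeral n.+1 a by rewrite (leq_trans _ le_a) // expn_gt0.
have eqC : numeral n.+1 c * (n * numeral n.+1 a + b) =
           numeral n.+1 a * b * n.+1 ^ k by lia.
have Bk_gt0 : 0 < n.+1 ^ k by rewrite expn_gt0.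
case: nz => _ _ nz_bc.
have b_gt0 : 0 < b by rewrite lt0n; apply/eqP=> b0; apply: nz_bc; nia.
have c_gt0 : 0 < numeral n.+1 c by rewrite lt0n; apply/eqP=> c0; nia.
have le_c := leq_repdigit n k _ b _ ltac:(lia) c_gt0 eqC.
have eq_a t := defect_eq n k (numeral n.+1 a) b (numeral n.+1 c) t.
have neq_c : numeral n.+1 c <> b * repunit n.+1 k.
  (* Defect 0 gives a = c = b R, hence every digit is b. *)
  move=> eq_c; have /eqP := eq_a 0 ltac:(by rewrite addn0) eqC.
  rewrite muln0 addn0 mulnC eqn_pmul2l // => /eqP eq_ac.
  have dig_nseq : all (is_digit n.+1) (nseq k b).
    by rewrite all_nseq [is_digit _ _]lt_b orbT.
  have cE : c = nseq k b.
    by apply: (numeral_inj n.+1); rewrite ?size_nseq ?numeral_nseq.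
  have aE : a = nseq k b.
    by apply: (numeral_inj n.+1); rewrite ?size_nseq ?numeral_nseq ?eq_ac.
  move/negP: ncst; apply; rewrite aE cE -[b :: _]/(nseq k.+1 b) -nseqD.
  exact: constant_nseq.
have t_bnd := defect_range n k _ b _ k_gt0 ltac:(lia) c_gt0 le_a neq_c eqC.
exists b, (b * repunit n.+1 k - numeral n.+1 c); split=> //.
rewrite /defect_solution subKn // -(eq_a _ (subnKC le_c) eqC) /=.
rewrite mulnK ?addn_gt0 ?b_gt0 //.
by rewrite numeral_cat numeral_cons /= sz_c.
Qed.

Lemma size_solutions (B k : nat) (s : seq nat) : 1 < B -> 0 < k -> uniq s ->
    (forall N, N \in s -> solution_Pstar B k N) ->
  size s <= 'C(B - 2, 2).
Proof.
move=> B_gt1 k_gt0 s_uniq s_sol.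
pose sols :=
  [seq defect_solution B k j.+2 i.+1 | j <- iota 0 (B - 2), i <- iota 0 j].
have -> : 'C(B - 2, 2) = size sols.
  rewrite size_allpairs_dep -bin2_sum sumnE big_map /index_iota subn0.
  by apply: eq_bigr => j _; rewrite size_iota.
apply: uniq_leq_size => // N /s_sol /solution_defect.
move=> /(_ B_gt1 k_gt0) [b [t [t_bnd lt_b ->]]].
have [-> ->] : b = (b - 2).+2 /\ t = t.-1.+1 by lia.
by apply: allpairs_f_dep; rewrite mem_iota /=; lia.
Qed.

Local Open Scope ring_scope.

Theorem proposition4 (B k : nat) (hB : (2 <= B)%N) (hk : (1 <= k)%N)
    (s : seq nat) (s_uniq : uniq s)
    (s_sol : forall N : nat, N \in s -> solution_Pstar B k N) :
  (size s)%:R <= (B%:R - 2) * (B%:R - 3) / 2 :> rat.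
Proof.
apply: (@le_trans _ _ ('C(B - 2, 2)%:R)).
  by rewrite ler_nat; apply: size_solutions s_sol.
rewrite -{2 3}(subnK hB); move: (B - 2)%N => m.
have eq_bin : ('C(m, 2) * 2 + m = m * m)%N.
  have -> : ('C(m, 2) * 2 = m * m.-1)%N.
    by rewrite -[in RHS](ffactn1 m.-1) -ffactnS -bin_ffact.
  by case: m => // m /=; rewrite -mulnSr.
have : ('C(m, 2) * 2 + m)%:R = (m * m)%:R :> rat by rewrite eq_bin.
by rewrite !natrD !natrM; lra.
Qed.
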